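(* Let $(\mathcal J,E)$ be a marked 2-category, $\mathcal C$ a 2-category, $F\colon\mathcal J\to\mathcal C$ a 2-functor, $\ell$ an object of $\mathcal C$ and $(\ell,\lambda)$ an $E$-lax cone over $F$. Then the canonical projection 2-functor $q\colon\overline{\mathcal C_{/F^\triangleleft}}\to\mathcal C_{/\ell}$ is a biequivalence.
   Context: Conventions. 2-categories and 2-functors are strict. Composition of 1-cells and whiskering are written by juxtaposition; $\beta\circ\alpha$ is vertical composition of 2-cells (first $\alpha$, then $\beta$). A marked 2-category $(\mathcal J,E)$ is a 2-category with a class $E$ of 1-cells containing all identities. $E$-lax cones. An $E$-lax cone $(x,\alpha)$ over $F\colon\mathcal J\to\mathcal C$ is an object $x$ of $\mathcal C$, 1-cells $\alpha_i\colon x\to Fi$ for each object $i$, and 2-cells $\alpha_k\colon F(k)\alpha_i\to\alpha_j$ for each 1-cell $k\colon i\to j$ of $\mathcal J$, such that $\alpha_{1_i}=1_{\alpha_i}$; $\alpha_{hk}=\alpha_h\circ(F(h)\alpha_k)$; $\alpha_k=\alpha_{k'}\circ(F(\Lambda)\alpha_i)$ for each 2-cell $\Lambda\colon k\to k'$; and $\alpha_k$ is invertible for $k\in E$. Lax slice $\mathcal C_{/\ell}$. Objects: pairs $(x,h)$ with $h\colon x\to\ell$. 1-cells $(x,h)\to(y,g)$: pairs $(f,\zeta)$ with $f\colon x\to y$ and a 2-cell $\zeta\colon gf\to h$. 2-cells $(f,\zeta)\to(f',\zeta')$: 2-cells $\Xi\colon f\to f'$ with $\zeta'\circ(g\Xi)=\zeta$.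 Composition: $(f',\zeta')(f,\zeta)=(f'f,\ \zeta\circ(\zeta' f))$. Modified 2-category of cones $\overline{\mathcal C_{/F^\triangleleft}}$ (for the fixed cone $(\ell,\lambda)$). Objects: $(x,h,\alpha,\sigma)$ with $h\colon x\to\ell$ a 1-cell, $(x,\alpha)$ an $E$-lax cone over $F$, and invertible 2-cells $\sigma_i\colon\lambda_i h\to\alpha_i$ with $\alpha_k\circ(F(k)\sigma_i)=\sigma_j\circ(\lambda_k h)$ for all $k\colon i\to j$. 1-cells $(x,h,\alpha,\sigma)\to(y,g,\beta,\tau)$: triples $(f,\zeta,\mu)$ with $f\colon x\to y$ a 1-cell, $\zeta\colon gf\to h$ a 2-cell, and 2-cells $\mu_i\colon\beta_i f\to\alpha_i$ with $\alpha_k\circ(F(k)\mu_i)=\mu_j\circ(\beta_k f)$ for all $k\colon i\to j$ and $\mu_i\circ(\tau_i f)=\sigma_i\circ(\lambda_i\zeta)$ for all $i$. 2-cells $(f,\zeta,\mu)\to(f',\zeta',\mu')$: 2-cells $\Xi\colon f\to f'$ with $\zeta'\circ(g\Xi)=\zeta$ and $\mu'_i\circ(\beta_i\Xi)=\mu_i$ for all $i$. Composition: $(f',\zeta',\mu')(f,\zeta,\mu)=(f'f,\ \zeta\circ(\zeta' f),\ (\mu_i\circ(\mu'_i f))_i)$. The projection $q$ sends $(x,h,\alpha,\sigma)\mapsto(x,h)$, $(f,\zeta,\mu)\mapsto(f,\zeta)$, $\Xi\mapsto\Xi$. Biequivalence: a 2-functor that induces equivalences on all hom-categories and such that every object of the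 target is equivalent to one in the image. *)

(* Defs.v *)
From Stdlib Require Import ProofIrrelevance FunctionalExtensionality.

Set Implicit Arguments.
Unset Strict Implicit.
#[local] Obligation Tactic := simpl; intros; simpl in *.

Declare Scope two_scope.
Delimit Scope two_scope with two.
Open Scope two_scope.

Reserved Notation "b ∘ a" (at level 40, left associativity).
Reserved Notation "g ∙ f" (at level 34, left associativity).
Reserved Notation "b ⋆ a" (at level 34, left associativity).
Reserved Notation "g ◁ a" (at level 34, left associativity).
Reserved Notation "b ▷ f" (at level 34, left associativity).
Reserved Notation "a ≡ b" (at level 70, no associativity).

Record Category := {
  obj :> Type;
  mor : obj -> obj -> Type;
  idm : forall a, mor a a;
  cmp : forall a b c, mor b c -> mor a b -> mor a c;
  cmp_assoc : forall a b c d (h : mor c d) (g : mor b c) (f : mor a b),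
    cmp h (cmp g f) = cmp (cmp h g) f;
  cmp_idl : forall a b (f : mor a b), cmp (idm b) f = f;
  cmp_idr : forall a b (f : mor a b), cmp f (idm a) = f }.

Arguments mor {c} _ _ : rename.
Arguments idm {c} _ : rename.
Arguments cmp {_ a b c} _ _.

Notation "b ∘ a" := (cmp b a) : two_scope.

Definition is_inverse (C : Category) (a b : C) (f : mor a b) (g : mor b a) : Prop :=
  g ∘ f = idm a /\ f ∘ g = idm b.

Definition invertible (C : Category) (a b : C) (f : mor a b) : Prop :=
  exists g : mor b a, is_inverse f g.

Definition isomorphic (C : Category) (a b : C) : Prop :=
  exists f : mor a b, invertible f.

Record Functor (C D : Category) := {
  fobj :> C -> D;
  fmor : forall a b, mor a b -> mor (fobj a) (fobj b);
  fmor_id : forall a, fmor (idm a) = idm (fobj a);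
  fmor_cmp : forall a b c (g : mor b c) (f : mor a b),
    fmor (g ∘ f) = fmor g ∘ fmor f }.

Arguments fmor {C D} _ {a b} _.

Definition functor_id (C : Category) : Functor C C :=
  {| fobj := fun a => a;
     fmor := fun _ _ f => f;
     fmor_id := fun _ => eq_refl;
     fmor_cmp := fun _ _ _ _ _ => eq_refl |}.

Program Definition functor_cmp (C D D' : Category) (G : Functor D D') (F : Functor C D)
  : Functor C D' :=
  {| fobj := fun a => G (F a);
     fmor := fun _ _ f => fmor G (fmor F f) |}.
Next Obligation. now rewrite !fmor_id. Qed.
Next Obligation. now rewrite !fmor_cmp. Qed.

Definition naturally_isomorphic (C D : Category) (F G : Functor C D) : Prop :=
  exists t : forall a, mor (F a) (G a),
    (forall a b (f : mor a b), fmor G f ∘ t a = t b ∘ fmor F f) /\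
    (forall a, invertible (t a)).

Definition is_equivalence (C D : Category) (F : Functor C D) : Prop :=
  exists G : Functor D C,
    naturally_isomorphic (functor_cmp G F) (functor_id C) /\
    naturally_isomorphic (functor_cmp F G) (functor_id D).

(** [f ≡ g] says that [f] and [g] have equal sources, equal targets, and are the
  same morphism.  It is how strict equations between 2-cells are stated when
  their boundaries differ by strict associativity, unit laws or functoriality. *)

Inductive heq (C : Category) (a b : C) (f : mor a b)
  : forall a' b' : C, mor a' b' -> Prop :=
| heq_refl : heq f f.

Notation "f ≡ g" := (heq f g) : two_scope.

(** Transport of a morphism along an equality of sources. *)
Definition castdom (C : Category) (a a' b : C) (e : a = a') (f : mor a b) : mor a' b :=
  match e in _ = x return mor x b with eq_refl => f end.

Section HeqTheory.
Variable C : Category.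

Lemma heq_eq (a b : C) (f g : mor a b) : f ≡ g -> f = g.
Proof.
  intros H.
  assert (K : existT (fun a => {b & mor a b}) a (existT _ b f)
            = existT (fun a => {b & mor a b}) a (existT _ b g))
    by (destruct H; reflexivity).
  exact (inj_pairT2 _ _ _ _ _ (inj_pairT2 _ _ _ _ _ K)).
Qed.

Lemma eq_heq (a b : C) (f g : mor a b) : f = g -> f ≡ g.
Proof. intros []; constructor. Qed.

Lemma heq_sym (a b a' b' : C) (f : mor a b) (g : mor a' b') : f ≡ g -> g ≡ f.
Proof. intros []; constructor. Qed.

Lemma heq_trans (a b a' b' a'' b'' : C)
  (f : mor a b) (g : mor a' b') (h : mor a'' b'') : f ≡ g -> g ≡ h -> f ≡ h.
Proof. intros [] H; exact H. Qed.

Lemma heq_dom (a b a' b' : C) (f : mor a b) (g : mor a' b') : f ≡ g -> a = a'.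
Proof. intros []; reflexivity. Qed.

Lemma heq_cod (a b a' b' : C) (f : mor a b) (g : mor a' b') : f ≡ g -> b = b'.
Proof. intros []; reflexivity. Qed.

Lemma heq_cmp (a b c a' b' c' : C)
  (f : mor a b) (g : mor b c) (f' : mor a' b') (g' : mor b' c') :
  g ≡ g' -> f ≡ f' -> g ∘ f ≡ g' ∘ f'.
Proof.
  intros Hg Hf.
  pose proof (heq_dom Hf); pose proof (heq_cod Hf); pose proof (heq_cod Hg); subst.
  apply heq_eq in Hf; apply heq_eq in Hg; subst; constructor.
Qed.

Lemma heq_idm (a a' : C) : a = a' -> idm a ≡ idm a'.
Proof. intros []; constructor. Qed.

Lemma castdom_heq (a a' b : C) (e : a = a') (f : mor a b) : castdom e f ≡ f.
Proof. destruct e; constructor. Qed.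

End HeqTheory.

(** Strict 2-categories in enriched form: [hcomp_id] and [hcomp_cmp] say that
  composition is a functor [hom y z × hom x y -> hom x z], and the remaining
  axioms are strict associativity and unitality on 1-cells and 2-cells.
  Whiskering is horizontal composition with an identity 2-cell. *)

Record TwoCat := {
  ob :> Type;
  hom : ob -> ob -> Category;
  one : forall x, hom x x;
  comp : forall x y z, hom y z -> hom x y -> hom x z;
  hcomp : forall x y z (g g' : hom y z) (f f' : hom x y),
    mor g g' -> mor f f' -> mor (comp g f) (comp g' f');
  hcomp_id : forall x y z (g : hom y z) (f : hom x y),
    hcomp (idm g) (idm f) = idm (comp g f);
  hcomp_cmp : forall x y z (g g' g'' : hom y z) (f f' f'' : hom x y)
    (b' : mor g' g'') (b : mor g g') (a' : mor f' f'') (a : mor f f'),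
    hcomp (b' ∘ b) (a' ∘ a) = hcomp b' a' ∘ hcomp b a;
  comp_assoc : forall w x y z (h : hom y z) (g : hom x y) (f : hom w x),
    comp h (comp g f) = comp (comp h g) f;
  comp_onel : forall x y (f : hom x y), comp (one y) f = f;
  comp_oner : forall x y (f : hom x y), comp f (one x) = f;
  hcomp_assoc : forall w x y z (h h' : hom y z) (g g' : hom x y) (f f' : hom w x)
    (c : mor h h') (b : mor g g') (a : mor f f'),
    hcomp c (hcomp b a) ≡ hcomp (hcomp c b) a;
  hcomp_onel : forall x y (f f' : hom x y) (a : mor f f'), hcomp (idm (one y)) a ≡ a;
  hcomp_oner : forall x y (f f' : hom x y) (a : mor f f'), hcomp a (idm (one x)) ≡ a }.

Arguments hom {t} _ _ : rename.
Arguments one {t} _ : rename.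
Arguments comp {t x y z} _ _ : rename.
Arguments hcomp {t x y z g g' f f'} _ _ : rename.
Arguments comp_assoc {t w x y z} _ _ _ : rename.
Arguments comp_oner {t x y} _ : rename.
Arguments comp_onel {t x y} _ : rename.

Notation "g ∙ f" := (comp g f) : two_scope.
Notation "b ⋆ a" := (hcomp b a) : two_scope.
Notation "g ◁ a" := (hcomp (idm g) a) : two_scope.
Notation "b ▷ f" := (hcomp b (idm f)) : two_scope.

Definition equivalent_objects (C : TwoCat) (x y : C) : Prop :=
  exists (f : hom x y) (g : hom y x),
    isomorphic (g ∙ f) (one x) /\ isomorphic (f ∙ g) (one y).

Record TwoFunctor (C D : TwoCat) := {
  fun0 :> C -> D;
  fun1 : forall x y, Functor (hom x y) (hom (fun0 x) (fun0 y));
  fun1_one : forall x, fun1 x x (one x) = one (fun0 x);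
  fun1_comp : forall x y z (g : hom y z) (f : hom x y),
    fun1 x z (g ∙ f) = fun1 y z g ∙ fun1 x y f;
  fun1_hcomp : forall x y z (g g' : hom y z) (f f' : hom x y) (b : mor g g') (a : mor f f'),
    fmor (fun1 x z) (b ⋆ a) ≡ fmor (fun1 y z) b ⋆ fmor (fun1 x y) a }.

Arguments fun1 {C D} _ {x y} : rename.

Definition fun2 (C D : TwoCat) (F : TwoFunctor C D) (x y : C) (f f' : hom x y)
  (a : mor f f') : mor (fun1 F f) (fun1 F f') := fmor (fun1 F) a.

Definition biequivalence (C D : TwoCat) (F : TwoFunctor C D) : Prop :=
  (forall x y : C, is_equivalence (fun1 F (x := x) (y := y))) /\
  (forall d : D, exists c : C, equivalent_objects (F c) d).

Record MarkedTwoCat := {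
  underlying :> TwoCat;
  marked : forall i j : underlying, hom i j -> Prop;
  marked_one : forall i : underlying, marked (one i) }.

Arguments marked {m i j} _ : rename.

Section TwoCatTheory.
Variable C : TwoCat.

Lemma heq_hcomp (x y z : C) (g g' k k' : hom y z) (f f' h h' : hom x y)
  (b : mor g g') (a : mor f f') (b' : mor k k') (a' : mor h h') :
  b ≡ b' -> a ≡ a' -> b ⋆ a ≡ b' ⋆ a'.
Proof. intros [] []; constructor. Qed.

Lemma whisker_swap (x y z : C) (g g' : hom y z) (f f' : hom x y)
  (b : mor g g') (a : mor f f') : (b ▷ f') ∘ (g ◁ a) = (g' ◁ a) ∘ (b ▷ f).
Proof. now rewrite <- !hcomp_cmp, !cmp_idl, !cmp_idr. Qed.

Lemma rwhisk_cmp (x y z : C) (g g' g'' : hom y z) (f : hom x y)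
  (b' : mor g' g'') (b : mor g g') : (b' ∘ b) ▷ f = (b' ▷ f) ∘ (b ▷ f).
Proof. now rewrite <- hcomp_cmp, cmp_idl. Qed.

Lemma lwhisk_cmp (x y z : C) (g : hom y z) (f f' f'' : hom x y)
  (a' : mor f' f'') (a : mor f f') : g ◁ (a' ∘ a) = (g ◁ a') ∘ (g ◁ a).
Proof. now rewrite <- hcomp_cmp, cmp_idl. Qed.

Lemma lwhisk_lwhisk (w x y z : C) (h : hom y z) (g : hom x y) (f f' : hom w x)
  (a : mor f f') : h ◁ (g ◁ a) ≡ (h ∙ g) ◁ a.
Proof. rewrite <- hcomp_id; apply hcomp_assoc. Qed.

Lemma rwhisk_rwhisk (w x y z : C) (h h' : hom y z) (g : hom x y) (f : hom w x)
  (c : mor h h') : c ▷ (g ∙ f) ≡ (c ▷ g) ▷ f.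
Proof. rewrite <- hcomp_id; apply hcomp_assoc. Qed.

Lemma lwhisk_rwhisk (w x y z : C) (h : hom y z) (g g' : hom x y) (f : hom w x)
  (b : mor g g') : h ◁ (b ▷ f) ≡ (h ◁ b) ▷ f.
Proof. apply hcomp_assoc. Qed.

End TwoCatTheory.

(** For 1-cells [p : x -> z], [q : y -> z], [r : w -> z], a 2-cell [q ∙ f -> p]
  is pasted with a 2-cell [r ∙ f' -> q] to [r ∙ (f' ∙ f) -> p]; the cast only
  reassociates the source. *)

Definition paste_id (C : TwoCat) (x z : C) (p : hom x z) : mor (p ∙ one x) p :=
  castdom (eq_sym (comp_oner p)) (idm p).

Definition paste (C : TwoCat) (x y w z : C)
  (p : hom x z) (q : hom y z) (r : hom w z) (f' : hom y w) (f : hom x y)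
  (m' : mor (r ∙ f') q) (m : mor (q ∙ f) p) : mor (r ∙ (f' ∙ f)) p :=
  castdom (eq_sym (comp_assoc r f' f)) (m ∘ (m' ▷ f)).

Section PasteTheory.
Variable C : TwoCat.

Lemma paste_id_heq (x z : C) (p : hom x z) : paste_id p ≡ idm p.
Proof. apply castdom_heq. Qed.

Lemma paste_heq (x y w z : C) (p : hom x z) (q : hom y z) (r : hom w z)
  (f' : hom y w) (f : hom x y) (m' : mor (r ∙ f') q) (m : mor (q ∙ f) p) :
  paste m' m ≡ m ∘ (m' ▷ f).
Proof. apply castdom_heq. Qed.

Lemma paste_idl (x y z : C) (p : hom x z) (q : hom y z) (f : hom x y)
  (m : mor (q ∙ f) p) : paste (paste_id q) m ≡ m.
Proof.
  eapply heq_trans; [apply paste_heq|].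
  eapply heq_trans; [|apply eq_heq, cmp_idr].
  apply heq_cmp; [constructor|].
  rewrite <- hcomp_id; apply heq_hcomp; [apply paste_id_heq|constructor].
Qed.

Lemma paste_idr (x y z : C) (p : hom x z) (q : hom y z) (f : hom x y)
  (m : mor (q ∙ f) p) : paste m (paste_id p) ≡ m.
Proof.
  eapply heq_trans; [apply paste_heq|].
  eapply heq_trans; [|apply eq_heq, cmp_idl].
  apply heq_cmp; [apply paste_id_heq|apply hcomp_oner].
Qed.

Lemma paste_assoc (x y w v z : C) (p : hom x z) (q : hom y z) (r : hom w z) (s : hom v z)
  (f : hom x y) (f' : hom y w) (f'' : hom w v)
  (m : mor (q ∙ f) p) (m' : mor (r ∙ f') q) (m'' : mor (s ∙ f'') r) :
  paste m'' (paste m' m) ≡ paste (paste m'' m') m.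
Proof.
  eapply heq_trans; [apply paste_heq|].
  eapply heq_trans; [|apply heq_sym, paste_heq].
  eapply heq_trans.
  { apply heq_cmp; [apply paste_heq|apply rwhisk_rwhisk]. }
  rewrite <- cmp_assoc, <- rwhisk_cmp.
  apply heq_cmp; [constructor|].
  apply heq_hcomp; [apply heq_sym, paste_heq|constructor].
Qed.

Lemma paste_hcomp (x y w z : C) (p : hom x z) (q : hom y z) (r : hom w z)
  (f1 f2 : hom x y) (g1 g2 : hom y w)
  (m1 : mor (q ∙ f1) p) (m2 : mor (q ∙ f2) p)
  (n1 : mor (r ∙ g1) q) (n2 : mor (r ∙ g2) q)
  (a : mor f1 f2) (b : mor g1 g2) :
  m2 ∘ (q ◁ a) = m1 -> n2 ∘ (r ◁ b) = n1 ->
  paste n2 m2 ∘ (r ◁ (b ⋆ a)) = paste n1 m1.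
Proof.
  intros <- <-; apply heq_eq.
  eapply heq_trans; [apply heq_cmp; [apply paste_heq|apply hcomp_assoc]|].
  eapply heq_trans; [|apply heq_sym, paste_heq].
  apply eq_heq.
  rewrite <- !cmp_assoc, <- !hcomp_cmp, !cmp_idl, !cmp_idr; reflexivity.
Qed.

End PasteTheory.

Section LaxSlice.
Variables (C : TwoCat) (l : C).

Record SliceOb := { so_ob :> C; so_leg : hom so_ob l }.

Record SliceMor (X Y : SliceOb) := {
  sm_mor : hom X Y;
  sm_cell : mor (so_leg Y ∙ sm_mor) (so_leg X) }.

Definition SliceCell (X Y : SliceOb) (u v : SliceMor X Y) : Type :=
  {a : mor (sm_mor u) (sm_mor v) | sm_cell v ∘ (so_leg Y ◁ a) = sm_cell u}.

Lemma slice_mor_eq (X Y : SliceOb) (u v : SliceMor X Y) :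
  sm_mor u = sm_mor v -> sm_cell u ≡ sm_cell v -> u = v.
Proof.
  destruct u as [f z], v as [f' z']; simpl; intros <- H.
  now apply heq_eq in H; subst.
Qed.

Lemma slice_cell_eq (X Y : SliceOb) (u v : SliceMor X Y) (a b : SliceCell u v) :
  proj1_sig a = proj1_sig b -> a = b.
Proof. destruct a, b; simpl; intros; now apply subset_eq_compat. Qed.

Program Definition slice_hom (X Y : SliceOb) : Category :=
  {| obj := SliceMor X Y;
     mor := @SliceCell X Y;
     idm := fun u => exist _ (idm (sm_mor u)) _;
     cmp := fun u v w b a => exist _ (proj1_sig b ∘ proj1_sig a) _ |}.
Next Obligation. now rewrite hcomp_id, cmp_idr. Qed.
Next Obligation.
  destruct a as [a <-], b as [b <-]; simpl.
  now rewrite lwhisk_cmp, cmp_assoc.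
Qed.
Next Obligation. apply slice_cell_eq, cmp_assoc. Qed.
Next Obligation. apply slice_cell_eq, cmp_idl. Qed.
Next Obligation. apply slice_cell_eq, cmp_idr. Qed.

Lemma slice_heq (X Y : SliceOb) (u v u' v' : slice_hom X Y) (a : mor u v) (b : mor u' v') :
  u = u' -> v = v' -> proj1_sig a ≡ proj1_sig b -> a ≡ b.
Proof. intros <- <- H; now apply eq_heq, slice_cell_eq, heq_eq. Qed.

Definition slice_one (X : SliceOb) : slice_hom X X :=
  {| sm_mor := one X; sm_cell := paste_id (so_leg X) |}.

Definition slice_comp (X Y Z : SliceOb) (v : slice_hom Y Z) (u : slice_hom X Y)
  : slice_hom X Z :=
  {| sm_mor := sm_mor v ∙ sm_mor u; sm_cell := paste (sm_cell v) (sm_cell u) |}.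

Lemma slice_assoc (W X Y Z : SliceOb)
  (w : slice_hom Y Z) (v : slice_hom X Y) (u : slice_hom W X) :
  slice_comp w (slice_comp v u) = slice_comp (slice_comp w v) u.
Proof. apply slice_mor_eq; [apply comp_assoc|apply paste_assoc]. Qed.

Lemma slice_onel (X Y : SliceOb) (u : slice_hom X Y) : slice_comp (slice_one Y) u = u.
Proof. apply slice_mor_eq; [apply comp_onel|apply paste_idl]. Qed.

Lemma slice_oner (X Y : SliceOb) (u : slice_hom X Y) : slice_comp u (slice_one X) = u.
Proof. apply slice_mor_eq; [apply comp_oner|apply paste_idr]. Qed.

Program Definition LaxSlice : TwoCat :=
  {| ob := SliceOb;
     hom := slice_hom;
     one := slice_one;
     comp := slice_comp;
     hcomp := fun X Y Z v v' u u' b a => exist _ (proj1_sig b ⋆ proj1_sig a) _;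
     comp_assoc := slice_assoc;
     comp_onel := slice_onel;
     comp_oner := slice_oner |}.
Next Obligation. apply paste_hcomp; [exact (proj2_sig a)|exact (proj2_sig b)]. Qed.
Next Obligation. apply slice_cell_eq, hcomp_id. Qed.
Next Obligation. apply slice_cell_eq, hcomp_cmp. Qed.
Next Obligation. apply slice_heq; [apply slice_assoc..|apply hcomp_assoc]. Qed.
Next Obligation. apply slice_heq; [apply slice_onel..|apply hcomp_onel]. Qed.
Next Obligation. apply slice_heq; [apply slice_oner..|apply hcomp_oner]. Qed.

End LaxSlice.

Record LaxCone (J : MarkedTwoCat) (C : TwoCat) (F : TwoFunctor J C) (x : C) := {
  leg : forall i : J, hom x (F i);
  str : forall (i j : J) (k : hom i j), mor (fun1 F k ∙ leg i) (leg j);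
  str_one : forall i : J, str (one i) ≡ idm (leg i);
  str_comp : forall (i j m : J) (h : hom j m) (k : hom i j),
    str (h ∙ k) ≡ str h ∘ (fun1 F h ◁ str k);
  str_cell : forall (i j : J) (k k' : hom i j) (L : mor k k'),
    str k = str k' ∘ (fun2 F L ▷ leg i);
  str_marked : forall (i j : J) (k : hom i j), marked k -> invertible (str k) }.

Arguments leg {J C F x} _ i.
Arguments str {J C F x} _ {i j} k.

Section ConeSlice.
Variables (J : MarkedTwoCat) (C : TwoCat) (F : TwoFunctor J C).
Variables (l : C) (lam : LaxCone F l).

(** Objects, 1-cells and 2-cells extend those of the lax slice: [co_slice] is
  [(x, h)] and [cm_slice] is [(f, ζ)]; [co_cone], [co_iso], [cm_leg] are [α], [σ],
  [μ]. *)
Record ConeOb := {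
  co_slice :> SliceOb l;
  co_cone : LaxCone F co_slice;
  co_iso : forall i : J, mor (leg lam i ∙ so_leg co_slice) (leg co_cone i);
  co_iso_invertible : forall i, invertible (co_iso i);
  co_iso_str : forall (i j : J) (k : hom i j),
    str co_cone k ∘ (fun1 F k ◁ co_iso i) ≡ co_iso j ∘ (str lam k ▷ so_leg co_slice) }.

Record ConeMor (X Y : ConeOb) := {
  cm_slice :> SliceMor X Y;
  cm_leg : forall i : J, mor (leg (co_cone Y) i ∙ sm_mor cm_slice) (leg (co_cone X) i);
  cm_leg_str : forall (i j : J) (k : hom i j),
    str (co_cone X) k ∘ (fun1 F k ◁ cm_leg i)
      ≡ cm_leg j ∘ (str (co_cone Y) k ▷ sm_mor cm_slice);
  cm_leg_iso : forall i : J,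
    cm_leg i ∘ (co_iso Y i ▷ sm_mor cm_slice)
      ≡ co_iso X i ∘ (leg lam i ◁ sm_cell cm_slice) }.

Definition ConeCell (X Y : ConeOb) (u v : ConeMor X Y) : Type :=
  {a : mor (sm_mor u) (sm_mor v) |
    sm_cell v ∘ (so_leg Y ◁ a) = sm_cell u /\
    forall i : J, cm_leg v i ∘ (leg (co_cone Y) i ◁ a) = cm_leg u i}.

Lemma cone_mor_eq (X Y : ConeOb) (u v : ConeMor X Y) :
  cm_slice u = cm_slice v -> (forall i, cm_leg u i ≡ cm_leg v i) -> u = v.
Proof.
  destruct u as [s m n o], v as [s' m' n' o']; simpl; intros <- H.
  assert (E : m = m')
    by (apply functional_extensionality_dep; intros i; apply heq_eq, H).
  subst m'; f_equal; apply proof_irrelevance.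
Qed.

Lemma cone_cell_eq (X Y : ConeOb) (u v : ConeMor X Y) (a b : ConeCell u v) :
  proj1_sig a = proj1_sig b -> a = b.
Proof. destruct a, b; simpl; intros; now apply subset_eq_compat. Qed.

Program Definition cone_hom (X Y : ConeOb) : Category :=
  {| obj := ConeMor X Y;
     mor := @ConeCell X Y;
     idm := fun u => exist _ (idm (sm_mor u)) _;
     cmp := fun u v w b a => exist _ (proj1_sig b ∘ proj1_sig a) _ |}.
Next Obligation. split; intros; now rewrite hcomp_id, cmp_idr. Qed.
Next Obligation.
  destruct a as [a [<- Ha]], b as [b [<- Hb]]; simpl; split; [|intros i];
    rewrite lwhisk_cmp, cmp_assoc; [|rewrite Hb, Ha]; reflexivity.
Qed.
Next Obligation. apply cone_cell_eq, cmp_assoc. Qed.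
Next Obligation. apply cone_cell_eq, cmp_idl. Qed.
Next Obligation. apply cone_cell_eq, cmp_idr. Qed.

Lemma cone_heq (X Y : ConeOb) (u v u' v' : cone_hom X Y) (a : mor u v) (b : mor u' v') :
  u = u' -> v = v' -> proj1_sig a ≡ proj1_sig b -> a ≡ b.
Proof. intros <- <- H; now apply eq_heq, cone_cell_eq, heq_eq. Qed.

Program Definition cone_one (X : ConeOb) : cone_hom X X :=
  {| cm_slice := slice_one X; cm_leg := fun i => paste_id (leg (co_cone X) i) |}.
Next Obligation.
  assert (H : str (co_cone X) k ∘ (fun1 F k ◁ paste_id (leg (co_cone X) i))
              ≡ str (co_cone X) k ∘ idm _).
  { apply heq_cmp; [constructor|].
    rewrite <- hcomp_id; apply heq_hcomp; [constructor|apply paste_id_heq]. }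
  eapply heq_trans; [exact H|clear H].
  rewrite cmp_idr, <- (cmp_idl (str (co_cone X) k)).
  apply heq_cmp; [apply heq_sym, paste_id_heq|].
  rewrite cmp_idl; apply heq_sym, hcomp_oner.
Qed.
Next Obligation.
  eapply heq_trans; [apply heq_cmp; [apply paste_id_heq|apply hcomp_oner]|].
  rewrite cmp_idl; eapply heq_trans; [apply eq_heq, eq_sym, cmp_idr|].
  apply heq_cmp; [constructor|].
  rewrite <- hcomp_id; apply heq_hcomp; [constructor|apply heq_sym, paste_id_heq].
Qed.

Program Definition cone_comp (X Y Z : ConeOb) (v : cone_hom Y Z) (u : cone_hom X Y)
  : cone_hom X Z :=
  {| cm_slice := slice_comp (cm_slice v) (cm_slice u);
     cm_leg := fun i => paste (cm_leg v i) (cm_leg u i) |}.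
Next Obligation.
  eapply heq_trans.
  { apply heq_cmp; [constructor|].
    apply heq_hcomp; [constructor|apply paste_heq]. }
  rewrite lwhisk_cmp, cmp_assoc.
  eapply heq_trans.
  { apply heq_cmp; [apply cm_leg_str|apply lwhisk_rwhisk]. }
  rewrite <- cmp_assoc, <- rwhisk_cmp.
  eapply heq_trans.
  { apply heq_cmp; [constructor|apply heq_hcomp; [apply cm_leg_str|constructor]]. }
  rewrite rwhisk_cmp, cmp_assoc.
  apply heq_cmp; [apply heq_sym, paste_heq|apply heq_sym, rwhisk_rwhisk].
Qed.
Next Obligation.
  eapply heq_trans.
  { apply heq_cmp; [apply paste_heq|apply rwhisk_rwhisk]. }
  rewrite <- cmp_assoc, <- rwhisk_cmp.
  eapply heq_trans.
  { apply heq_cmp; [constructor|apply heq_hcomp; [apply cm_leg_iso|constructor]]. }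
  rewrite rwhisk_cmp, cmp_assoc.
  eapply heq_trans.
  { apply heq_cmp; [apply cm_leg_iso|apply heq_sym, lwhisk_rwhisk]. }
  rewrite <- cmp_assoc, <- lwhisk_cmp.
  apply heq_cmp; [constructor|apply heq_hcomp; [constructor|apply heq_sym, paste_heq]].
Qed.

Lemma cone_assoc (W X Y Z : ConeOb)
  (w : cone_hom Y Z) (v : cone_hom X Y) (u : cone_hom W X) :
  cone_comp w (cone_comp v u) = cone_comp (cone_comp w v) u.
Proof.
  apply cone_mor_eq; [|intros i; apply paste_assoc].
  exact (slice_assoc (cm_slice w) (cm_slice v) (cm_slice u)).
Qed.

Lemma cone_onel (X Y : ConeOb) (u : cone_hom X Y) : cone_comp (cone_one Y) u = u.
Proof.
  apply cone_mor_eq; [exact (slice_onel (cm_slice u))|intros i; apply paste_idl].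
Qed.

Lemma cone_oner (X Y : ConeOb) (u : cone_hom X Y) : cone_comp u (cone_one X) = u.
Proof.
  apply cone_mor_eq; [exact (slice_oner (cm_slice u))|intros i; apply paste_idr].
Qed.

Program Definition ConeSlice : TwoCat :=
  {| ob := ConeOb;
     hom := cone_hom;
     one := cone_one;
     comp := cone_comp;
     hcomp := fun X Y Z v v' u u' b a => exist _ (proj1_sig b ⋆ proj1_sig a) _;
     comp_assoc := cone_assoc;
     comp_onel := cone_onel;
     comp_oner := cone_oner |}.
Next Obligation.
  destruct a as [a [Ha Ha']], b as [b [Hb Hb']]; split; [|intros i];
    now apply paste_hcomp.
Qed.
Next Obligation. apply cone_cell_eq, hcomp_id. Qed.
Next Obligation. apply cone_cell_eq, hcomp_cmp. Qed.
Next Obligation. apply cone_heq; [apply cone_assoc..|apply hcomp_assoc]. Qed.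
Next Obligation. apply cone_heq; [apply cone_onel..|apply hcomp_onel]. Qed.
Next Obligation. apply cone_heq; [apply cone_oner..|apply hcomp_oner]. Qed.

Program Definition cone_proj_hom (X Y : ConeSlice)
  : Functor (hom X Y) (@hom (LaxSlice l) (co_slice X) (co_slice Y)) :=
  {| fobj := fun u => cm_slice u;
     fmor := fun u v a => exist _ (proj1_sig a) _ |}.
Next Obligation. exact (proj1 (proj2_sig a)). Qed.
Next Obligation. now apply slice_cell_eq. Qed.
Next Obligation. now apply slice_cell_eq. Qed.

Program Definition cone_proj : TwoFunctor ConeSlice (LaxSlice l) :=
  {| fun0 := fun X => co_slice X;
     fun1 := cone_proj_hom |}.
Next Obligation. reflexivity. Qed.
Next Obligation. reflexivity. Qed.
Next Obligation. apply slice_heq; [reflexivity..|constructor]. Qed.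

End ConeSlice.

(* Main.v *)
(** Since [τ_i f] is invertible, the equation [μ_i ∘ (τ_i f) = σ_i ∘ (λ_i ζ)]
  determines [μ] from [(f, ζ)], and the [μ_i] so defined satisfy the modification
  axiom and are respected by every 2-cell of the slice.  Hence [q] is fully faithful
  and surjective on objects on each hom-category.  It is also surjective on objects,
  as [(x, h)] is the image of [(x, h, λ h, id)]. *)

Require Import Defs.
From Stdlib Require Import IndefiniteDescription.

Set Implicit Arguments.
Unset Strict Implicit.

Section Invertible.
Variable C : Category.

Lemma invertible_idm (a : C) : invertible (idm a).
Proof. exists (idm a); split; apply cmp_idl. Qed.

Lemma invertible_castdom (a a' b : C) (e : a = a') (f : mor a b) :
  invertible f -> invertible (castdom e f).
Proof. now destruct e. Qed.

(** Composing with a right inverse of [e] cancels it. Both [e] and [e'] appear because, in the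
    intended uses, the two sides may agree only after reassociating 1-cells. *)
Lemma heq_cancel_epi (a b c a' b' c' : C) (e : mor a b) (e' : mor a' b')
  (f : mor b c) (f' : mor b' c') :
  invertible e -> e ≡ e' -> f ∘ e ≡ f' ∘ e' -> f ≡ f'.
Proof.
  intros [r [_ Hr]] He H.
  destruct (heq_dom He), (heq_cod He); apply heq_eq in He; subst e'.
  rewrite <- (cmp_idr f), <- (cmp_idr f'), <- Hr, !cmp_assoc.
  apply heq_cmp; [exact H|constructor].
Qed.

Lemma isomorphic_eq (a b : C) : a = b -> isomorphic a b.
Proof. intros []; exists (idm a); apply invertible_idm. Qed.

End Invertible.

Lemma invertible_hcomp (C : TwoCat) (x y z : C) (g g' : hom y z) (f f' : hom x y)
  (b : mor g g') (a : mor f f') : invertible b -> invertible a -> invertible (b ⋆ a).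
Proof.
  intros [b' [Hb Hb']] [a' [Ha Ha']]; exists (b' ⋆ a'); split;
    rewrite <- hcomp_cmp, ?Hb, ?Hb', ?Ha, ?Ha'; apply hcomp_id.
Qed.

Lemma equivalent_objects_refl (C : TwoCat) (x : C) : equivalent_objects x x.
Proof.
  exists (one x), (one x); split; apply isomorphic_eq, comp_onel.
Qed.

(** The maps [lift] make [Q] fully faithful, so every equation can be checked after applying [Q].
    The pseudo-inverse is [s] on objects and conjugates morphisms by the identifications
    [Q (s d) = d]. *)
Lemma is_equivalence_of_section (C D : Category) (Q : Functor C D) (s : D -> C)
  (qs : forall d, Q (s d) = d)
  (lift : forall a b : C, mor (Q a) (Q b) -> mor a b)
  (lift_fmor : forall a b (f : mor a b), lift a b (fmor Q f) = f)
  (fmor_lift : forall a b (f : mor (Q a) (Q b)), fmor Q (lift a b f) = f) :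
  is_equivalence Q.
Proof.
  assert (faithful : forall a b (f g : mor a b), fmor Q f = fmor Q g -> f = g)
    by (intros a b f g H; now rewrite <- (lift_fmor _ _ f), H).
  (* Identities transported along [qs d]: mutually inverse maps between [d] and [Q (s d)]. *)
  pose (to := fun d => match eq_sym (qs d) in _ = y return mor d y with
                       | eq_refl => idm d end).
  pose (from := fun d => match eq_sym (qs d) in _ = y return mor y d with
                         | eq_refl => idm d end).
  assert (from_to : forall d, from d ∘ to d = idm d).
  { intros d; unfold from, to; destruct (eq_sym (qs d)); apply cmp_idl. }
  assert (to_from : forall d, to d ∘ from d = idm _).
  { intros d; unfold from, to; destruct (eq_sym (qs d)); apply cmp_idl. }
  unshelve eexists {| fobj := s;
    fmor := fun a b f => lift (s a) (s b) (to b ∘ f ∘ from a) |}.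
  - intros a; apply faithful.
    now rewrite fmor_lift, cmp_idr, to_from, fmor_id.
  - intros a b c g f; apply faithful.
    rewrite fmor_cmp, !fmor_lift, <- !cmp_assoc.
    now rewrite (cmp_assoc (from b) (to b)), from_to, cmp_idl.
  - split.
    + exists (fun a => lift _ _ (from (Q a))); simpl; split.
      * intros a b f; apply faithful.
        rewrite !fmor_cmp, !fmor_lift, !cmp_assoc.
        now rewrite from_to, cmp_idl.
      * intros a; exists (lift _ _ (to (Q a))); split; apply faithful;
          now rewrite fmor_cmp, !fmor_lift, fmor_id.
    + exists from; simpl; split.
      * intros a b f; now rewrite fmor_lift, !cmp_assoc, from_to, cmp_idl.
      * intros a; exists (to a); split; auto.
Qed.

Section Projection.
Variables (J : MarkedTwoCat) (C : TwoCat) (F : TwoFunctor J C).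
Variables (l : C) (lam : LaxCone F l).

(** After precomposing with the invertible $\tau_i f$, interchange moves $\Xi$ past $\tau_i$, and
    both sides become $\sigma_i\circ(\lambda_i\zeta)$. *)
Lemma cone_cell_of_slice_cell (X Y : ConeOb lam) (u v : ConeMor X Y)
  (a : mor (sm_mor u) (sm_mor v)) :
  sm_cell v ∘ (so_leg Y ◁ a) = sm_cell u ->
  forall i, cm_leg v i ∘ (leg (co_cone Y) i ◁ a) = cm_leg u i.
Proof.
  intros H i; apply heq_eq.
  apply heq_cancel_epi with (e := co_iso Y i ▷ sm_mor u) (e' := co_iso Y i ▷ sm_mor u).
  { apply invertible_hcomp; [apply co_iso_invertible|apply invertible_idm]. }
  { constructor. }
  eapply heq_trans; [|apply heq_sym, cm_leg_iso].
  rewrite <- H, <- cmp_assoc, <- whisker_swap, cmp_assoc, lwhisk_cmp, cmp_assoc.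
  apply heq_cmp; [apply cm_leg_iso|apply heq_sym, lwhisk_lwhisk].
Qed.

Lemma cone_mor_over (X Y : ConeOb lam) (s : SliceMor X Y) :
  exists u : ConeMor X Y, cm_slice u = s.
Proof.
  pose (inv := fun i => proj1_sig
    (constructive_indefinite_description _ (co_iso_invertible Y i))).
  assert (Hinv : forall i, inv i ∘ co_iso Y i = idm _).
  { intros i; exact (proj1 (proj2_sig
      (constructive_indefinite_description _ (co_iso_invertible Y i)))). }
  (* The forced choice $\mu_i=\sigma_i\circ(\lambda_i\zeta)\circ(\tau_i^{-1}f)$; the cast rebrackets
     $\lambda_i(gf)$ as $(\lambda_i g)f$. *)
  pose (m := fun i => castdom (comp_assoc (leg lam i) (so_leg Y) (sm_mor s))
    (co_iso X i ∘ (leg lam i ◁ sm_cell s)) ∘ (inv i ▷ sm_mor s)).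
  assert (Hm : forall i, m i ∘ (co_iso Y i ▷ sm_mor s)
                 ≡ co_iso X i ∘ (leg lam i ◁ sm_cell s)).
  { intros i; unfold m.
    rewrite <- cmp_assoc, <- rwhisk_cmp, Hinv, hcomp_id, cmp_idr.
    apply castdom_heq. }
  unshelve eexists {| cm_slice := s; cm_leg := m |}; [|exact Hm|reflexivity].
  intros i j k.
  (* The modification axiom is tested after precomposition with $F(k)\tau_i f$, where both sides
     equal $\sigma_j\circ(\lambda_j\zeta)\circ(\lambda_k gf)$. *)
  apply heq_cancel_epi with (e := fun1 F k ◁ (co_iso Y i ▷ sm_mor s))
                            (e' := (fun1 F k ◁ co_iso Y i) ▷ sm_mor s).
  { apply invertible_hcomp; [apply invertible_idm|].
    apply invertible_hcomp; [apply co_iso_invertible|apply invertible_idm]. }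
  { apply lwhisk_rwhisk. }
  apply heq_trans with (g := co_iso X j ∘ (leg lam j ◁ sm_cell s)
                               ∘ (str lam k ▷ (so_leg Y ∙ sm_mor s))).
  - rewrite <- cmp_assoc, <- lwhisk_cmp.
    eapply heq_trans.
    { apply heq_cmp; [constructor|apply heq_hcomp; [constructor|apply Hm]]. }
    rewrite lwhisk_cmp, cmp_assoc.
    eapply heq_trans.
    { apply heq_cmp; [apply co_iso_str|apply lwhisk_lwhisk]. }
    rewrite <- !cmp_assoc, whisker_swap; constructor.
  - apply heq_sym; rewrite <- cmp_assoc, <- rwhisk_cmp.
    eapply heq_trans.
    { apply heq_cmp; [constructor|apply heq_hcomp; [apply co_iso_str|constructor]]. }
    rewrite rwhisk_cmp, cmp_assoc.
    apply heq_cmp; [apply Hm|apply heq_sym, rwhisk_rwhisk].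
Qed.

Lemma cone_proj_hom_equivalence (X Y : ConeSlice lam) :
  is_equivalence (cone_proj_hom X Y).
Proof.
  (* Choosing a 1-cell over each slice 1-cell gives the section on objects of the hom-category. *)
  pose (s := fun d => constructive_indefinite_description _ (@cone_mor_over X Y d)).
  unshelve eapply (@is_equivalence_of_section _ _ (cone_proj_hom X Y) (fun d => proj1_sig (s d))).
  - intros u v a.
    exact (exist _ (proj1_sig a)
      (conj (proj2_sig a) (cone_cell_of_slice_cell (proj2_sig a)))).
  - intros d; exact (proj2_sig (s d)).
  - intros u v a; now apply cone_cell_eq.
  - intros u v a; now apply slice_cell_eq.
Qed.

(** The cone $\lambda h$. It is left transparent so that its legs compute to $\lambda_i h$, which
    lets identities serve as the $\sigma_i$ below. *)
Definition cone_restrict (x : C) (h : hom x l) : LaxCone F x.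
Proof.
  refine {| leg := fun i => leg lam i ∙ h;
            str := fun i j k => castdom (eq_sym (comp_assoc _ _ _)) (str lam k ▷ h) |}.
  - intros i; eapply heq_trans; [apply castdom_heq|].
    rewrite <- hcomp_id; apply heq_hcomp; [apply str_one|constructor].
  - intros i j m h' k; eapply heq_trans; [apply castdom_heq|].
    eapply heq_trans; [apply heq_hcomp; [apply str_comp|constructor]|].
    rewrite rwhisk_cmp.
    apply heq_cmp; [apply heq_sym, castdom_heq|].
    eapply heq_trans; [apply heq_sym, lwhisk_rwhisk|].
    apply heq_hcomp; [constructor|apply heq_sym, castdom_heq].
  - intros i j k k' L; apply heq_eq.
    eapply heq_trans; [apply castdom_heq|].
    rewrite (str_cell lam L), rwhisk_cmp.
    apply heq_cmp; apply heq_sym; [apply castdom_heq|apply rwhisk_rwhisk].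
  - intros i j k Hk; apply invertible_castdom, invertible_hcomp;
      [now apply str_marked|apply invertible_idm].
Defined.

Definition restricted_cone_ob (X : SliceOb l) : ConeOb lam.
Proof.
  refine {| co_slice := X; co_cone := cone_restrict (so_leg X);
            co_iso := fun i => idm (leg lam i ∙ so_leg X) |}.
  - intros i; apply invertible_idm.
  - intros i j k; simpl; rewrite hcomp_id, cmp_idl, cmp_idr.
    apply castdom_heq.
Defined.

End Projection.

Theorem proposition3p3p8 (J : MarkedTwoCat) (C : TwoCat) (F : TwoFunctor J C)
  (l : C) (lam : LaxCone F l) :
  biequivalence (cone_proj lam).
Proof.
  split.
  - exact (@cone_proj_hom_equivalence J C F l lam).
  (* The image of this object reduces to [X] itself, so reflexivity suffices. *)
  - intros X; exists (restricted_cone_ob lam X); apply equivalent_objects_refl.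
Qed.
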